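(* Let $D$ be a digraph with adjacency matrix $A$ and spectral radius $\rho>0$, with irreducible components $D_1,\ldots,D_t$ having adjacency matrices $A_1,\ldots,A_t$. Suppose $A_1$ has spectral radius $\rho$ and $A_i$ has spectral radius different from (hence less than) $\rho$ for all $i\ge 2$, and suppose $D_1$ is aperiodic. Let $v_L,v_R$ be left and right $\rho$-eigenvectors of $A$ normalized so that $v_Lv_R=1$. Then for every row vector $w_L$ and column vector $w_R$ there exist $C,\epsilon>0$ such that for all $n\ge 0$ $$w_LA^nw_R=\big((w_Lv_R)(v_Lw_R)+p(n)\big)\rho^n,\qquad\text{where } |p(n)|<C(1-\epsilon)^n .$$
   Context: A digraph $D$ has vertex set $V=\{1,\ldots,n\}$ and a multiset $E$ of arcs (ordered pairs in $V\times V$); its adjacency matrix has $(i,j)$ entry equal to the multiplicity of $(i,j)$ in $E$. Walks may have length $0$. Irreducible components are maximal vertex sets (with induced subdigraphs) in which every vertex reaches every other by a walk. A digraph is $p$-cyclic if its vertices can be partitioned into classes $P_0,\ldots,P_{p-1}$ with every arc going from some $P_i$ to $P_{i+1 \bmod p}$; the period of an irreducible digraph is the largest such $p$, and it is aperiodic if its period is $1$. The spectral radius is the maximum modulus of an eigenvalue. *)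

(* Defs.v *)
From mathcomp Require Import all_boot all_order all_algebra.
From mathcomp Require Import reals complex.

Set Implicit Arguments.
Unset Strict Implicit.
Unset Printing Implicit Defensive.

Import Order.TTheory GRing.Theory Num.Theory.

Local Open Scope ring_scope.
Local Open Scope complex_scope.

(* The finite multiset of arcs is given by its multiplicity function. *)
Definition digraph (n : nat) : Type := {ffun 'I_n * 'I_n -> nat}.

Definition arc n (D : digraph n) : rel 'I_n := [rel i j | (0 < D (i, j))%N].

(* [connect] is the reflexive transitive closure, so walks of length 0 count. *)
Definition irreducible n (D : digraph n) : bool :=
  [forall i, forall j, connect (arc D) i j].

(* The vertices of [S] are renumbered by [enum_val : 'I_#|S| -> 'I_n]. *)
Definition induced n (D : digraph n) (S : {set 'I_n}) : digraph #|S| :=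
  [ffun e : 'I_#|S| * 'I_#|S| => D (enum_val e.1, enum_val e.2)].

Definition components n (D : digraph n) : {set {set 'I_n}} :=
  [set S | maxset (fun S' : {set 'I_n} => irreducible (induced D S')) S].

(* [cl i] is the index of the class of [i]; surjectivity says that the classes
   P_0, ..., P_(p-1) of the partition are nonempty.  [ordS] is the successor
   modulo p. *)
Definition p_cyclic n (D : digraph n) (p : nat) : Prop :=
  exists cl : 'I_n -> 'I_p,
    (forall k, exists i, cl i = k) /\
    (forall i j, arc D i j -> cl j = ordS (cl i)).

Definition is_period n (D : digraph n) (p : nat) : Prop :=
  p_cyclic D p /\ (forall q, p_cyclic D q -> (q <= p)%N).

Definition aperiodic n (D : digraph n) : Prop := is_period D 1.

Definition adjacency (K : pzSemiRingType) n (D : digraph n) : 'M[K]_n :=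
  \matrix_(i, j) (D (i, j))%:R.

Definition is_spectral_radius (R : realType) n (A : 'M[R[i]]_n) (rho : R) :
    Prop :=
  (exists2 a, eigenvalue A a & `|a| = rho%:C) /\
  (forall a, eigenvalue A a -> `|a| <= rho%:C).

(* Main.v *)
(* Let [B = A - rho vR vL].  On vectors annihilated by [vL] the powers of [A] and
   [B] agree, so it suffices that all eigenvalues of [B] have modulus less than
   [rho]: by Cayley-Hamilton the sequence [wL B^n w] is then [O(r^n)] for some
   [r < rho].  An eigenvector of [B] for a nonzero eigenvalue is an eigenvector [x]
   of [A] with [x vR = 0].  If its eigenvalue had modulus [rho], then [D1] would be
   the only component that can be a source of the support of [x], and
   Perron-Frobenius theory on [D1] would make [x] and [vL] proportional there,
   hence everywhere, contradicting [vL vR = 1]. *)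
Require Import Defs.
From mathcomp Require Import all_boot all_order all_algebra.
From mathcomp Require Import reals complex.

Set Implicit Arguments.
Unset Strict Implicit.
Unset Printing Implicit Defensive.

Import Order.TTheory GRing.Theory Num.Theory.

Local Open Scope ring_scope.
Local Open Scope complex_scope.

(** * Growth of matrix powers under a bound on the eigenvalues *)

Lemma mxBZE (K : pzRingType) m n (u v : 'M[K]_(m, n)) c i j :
  (u - c *: v) i j = u i j - c * v i j.
Proof. by rewrite !mxE. Qed.

Lemma mulmx_exprS (K : pzSemiRingType) m n (u : 'M[K]_(m, n)) (A : 'M[K]_n) k :
  u *m A ^+ k.+1 = u *m A *m A ^+ k.
Proof. by rewrite exprS -[_ * _]/(_ *m _) mulmxA. Qed.

Lemma mulmx_exprSr (K : pzSemiRingType) m n (u : 'M[K]_(m, n)) (A : 'M[K]_n) k :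
  u *m A ^+ k.+1 = u *m A ^+ k *m A.
Proof. by rewrite exprSr -[_ * _]/(_ *m _) mulmxA. Qed.

(** Splitting off the root [z] gives the recurrence [a k.+1 = z * a k + b k], where [b] is the
    sequence of [u *m (B - z%:M)] and is [O(r^k)] by induction. Since [|z| < r] strictly, the same
    rate survives, even for repeated roots. *)
Lemma annihilated_exp_bound (K : numFieldType) n (B : 'M[K]_n) (r : K)
    (s : seq K) (v : 'cV[K]_n) :
    0 < r -> {in s, forall z, `|z| < r} ->
  forall u : 'rV[K]_n, u *m \prod_(z <- s) (B - z%:M) = 0 ->
  exists C, forall k, `|(u *m B ^+ k *m v) 0 0| <= C * r ^+ k.
Proof.
move=> r_gt0; elim: s => [|z s IHs] s_lt u.
  rewrite big_nil mulmx1 => ->; exists 0 => k.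
  by rewrite !mul0mx mxE normr0 mul0r.
rewrite big_cons -[_ * _]/(_ *m _) mulmxA => u_eq0.
have z_lt : `|z| < r by rewrite s_lt ?mem_head.
have rz_gt0 : 0 < r - `|z| by rewrite subr_gt0.
have [|C' HC'] := IHs _ _ u_eq0.
  by move=> y ys; rewrite s_lt // in_cons ys orbT.
have C'_ge0 : 0 <= C'.
  by have := HC' 0; rewrite expr0 mulr1; apply: le_trans.
pose a k := (u *m B ^+ k *m v) 0 0.
have aS k : a k.+1 = z * a k + (u *m (B - z%:M) *m B ^+ k *m v) 0 0.
  have -> : u *m (B - z%:M) *m B ^+ k *m v =
      u *m B ^+ k.+1 *m v - z *: (u *m B ^+ k *m v).
    by rewrite mulmxBr mul_mx_scalar !mulmxBl -!scalemxAl mulmx_exprS.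
  by rewrite /a mxBZE [RHS]addrC subrK.
(* This constant [C] satisfies [|z| C + C' <= r C], which closes the induction on [k]. *)
exists (`|a 0| + C' / (r - `|z|)); elim=> [|k IHk].
  by rewrite expr0 mulr1 lerDl divr_ge0 // ltW.
rewrite -/(a k.+1) aS exprS (le_trans (ler_normD _ _)) // normrM.
rewrite (le_trans (lerD (ler_wpM2l (normr_ge0 z) IHk) (HC' k))) //.
rewrite !mulrA -mulrDl ler_wpM2r ?exprn_ge0 ?(ltW r_gt0) //.
rewrite [_ * r]mulrC -lerBrDl -mulrBl mulrDr [X in _ <= _ + X]mulrC divfK ?gt_eqF //.
by rewrite lerDr mulr_ge0 // ltW.
Qed.

(** By Cayley-Hamilton, the product of [B - z%:M] over the roots [z] of the characteristic
    polynomial vanishes, hence annihilates every [u]. *)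
Lemma exp_bound (K : numClosedFieldType) n (B : 'M[K]_n) (r : K) :
    0 < r -> (forall a, eigenvalue B a -> `|a| < r) ->
  forall (u : 'rV[K]_n) (v : 'cV[K]_n),
  exists C, forall k, `|(u *m B ^+ k *m v) 0 0| <= C * r ^+ k.
Proof.
case: n B => [|n] B r_gt0 B_lt u v.
  by exists 0 => k; rewrite mxE big_ord0 normr0 mul0r.
have [s charB] := closed_field_poly_normal (char_poly B).
move: charB; rewrite (monicP (char_poly_monic B)) scale1r => charB.
apply: (@annihilated_exp_bound _ _ _ _ s) => // [z zs|].
  by apply: B_lt; rewrite eigenvalue_root_char charB root_prod_XsubC.
have := Cayley_Hamilton B; rewrite charB rmorph_prod /=.
under eq_bigr do rewrite rmorphB /= horner_mx_X horner_mx_C.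
by move->; rewrite mulmx0.
Qed.

Lemma eigenvalue_seq (K : numClosedFieldType) n (B : 'M[K]_n) :
  {s : seq K | forall a, eigenvalue B a = (a \in s)}.
Proof.
have [s charB] := closed_field_poly_normal (char_poly B).
exists s => a; rewrite eigenvalue_root_char charB.
by rewrite (monicP (char_poly_monic B)) scale1r root_prod_XsubC.
Qed.

Lemma spectral_gap (R : realType) n (B : 'M[R[i]]_n) (rho : R) :
    0 < rho -> (forall a, eigenvalue B a -> `|a| < rho%:C) ->
  exists r : R, [/\ 0 < r, r < rho & forall a, eigenvalue B a -> `|a| < r%:C].
Proof.
have [s sE] := eigenvalue_seq B => rho_gt0 B_lt.
have {B_lt} : {in s, forall a, `|a| < rho%:C}.
  by move=> a; rewrite -sE; apply: B_lt.
(* Attaching [|a| < rho] to each element lets the induction run over an arbitrary list. Each step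
   takes the maximum with the midpoint of [|a|] and [rho]. *)
have [r [r_gt0 r_lt rP]] : exists r : R,
    [/\ 0 < r, r < rho & {in s, forall a, `|a| < rho%:C -> `|a| < r%:C}].
  elim: s {sE} => [|a s [r [r_gt0 r_lt rP]]].
    by exists (rho / 2); rewrite divr_gt0 // ltr_pdivrMr // ltr_pMr // ltr1n.
  have /complex_realP[t na] := normr_real a.
  have [a_ge|a_lt] := leP rho t.
    exists r; split=> // b; rewrite in_cons => /orP[/eqP-> | /rP//].
    by rewrite na ltcR ltNge a_ge.
  have [a_lt1 a_lt2] := midf_lt a_lt.
  set q := (_ / _) in a_lt1 a_lt2.
  exists (Num.max r q); rewrite lt_max gt_max r_gt0 r_lt a_lt2; split=> // b.
  rewrite in_cons => /orP[/eqP-> _|bs b_lt].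
    by rewrite na ltcR lt_max a_lt1 orbT.
  by rewrite (lt_le_trans (rP _ bs b_lt)) // lecR le_max lexx.
by move=> s_lt; exists r; split=> // a; rewrite sE => as_; apply: rP; rewrite ?s_lt.
Qed.

Lemma geometric_dominates (R : realType) (r s c C : R) :
  0 < r -> r < s -> 0 < c -> exists k, C * r ^+ k < c * s ^+ k.
Proof.
move=> r_gt0 rs c_gt0; pose h := s / r - 1.
have h_gt0 : 0 < h by rewrite subr_gt0 ltr_pdivlMr // mul1r.
have bernoulli k : 1 + h *+ k <= (1 + h) ^+ k.
  elim: k => [|k IHk]; first by rewrite mulr0n addr0.
  rewrite exprS; apply: le_trans (ler_wpM2l _ IHk); last by rewrite addr_ge0 // ltW.
  rewrite mulrDl mul1r mulrDr mulr1 mulrSr addrA [leRHS]addrA.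
  by rewrite lerDl mulr_ge0 ?mulrn_wge0 // ltW.
(* [x] solves [c * (h * x) = C]; by Bernoulli any natural number above it serves as exponent. *)
set x := h^-1 * (c^-1 * C); exists (Num.bound `|x|).
set k := Num.bound _.
have sE : s = r * (1 + h) by rewrite /h addrC subrK mulrC divfK ?gt_eqF.
rewrite sE exprMn [r ^+ k * _]mulrC mulrA ltr_pM2r ?exprn_gt0 //.
rewrite -ltr_pdivrMl // (lt_le_trans _ (bernoulli k)) //.
rewrite (le_lt_trans (y := h *+ k)) ?ltrDr // -mulr_natr -ler_pdivrMl //.
by rewrite -/x (le_trans (ler_norm _)) // ltW ?archi_boundP ?normr_ge0.
Qed.

(** * Nonnegative matrices: subinvariant vectors and positivity *)

(** Iteration gives [y A^k >= s^k y] entrywise, while the eigenvalue bound makes the entries of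
    [y A^k] grow as [O(r^k)] for any [r > rho]. If [rho < s], an [r] between them gives a
    contradiction at a positive entry of [y]. *)
Lemma subinvariant_le (R : realType) n (A : 'M[R[i]]_n) (rho s : R)
    (y : 'rV[R[i]]_n) :
    0 < rho -> (forall i j, 0 <= A i j) ->
    (forall a, eigenvalue A a -> `|a| <= rho%:C) ->
    (forall i, 0 <= y 0 i) -> y != 0 ->
    (forall j, s%:C * y 0 j <= (y *m A) 0 j) ->
  s <= rho.
Proof.
move=> rho_gt0 A_ge0 A_le y_ge0 /rV0Pn[i yi_neq0] y_sub.
rewrite leNgt; apply/negP => rho_lt.
have [r_gt r_lt] := midf_lt rho_lt; set r := (_ / _) in r_gt r_lt.
have r_gt0 : 0 < r := lt_trans rho_gt0 r_gt.
have s_ge0 : 0 <= s%:C by rewrite lecR ltW // (lt_trans r_gt0).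
have [||C HC] := @exp_bound _ _ A r%:C _ _ y (delta_mx i 0).
- by rewrite ltcR.
- by move=> a /A_le a_le; rewrite (le_lt_trans a_le) ?ltcR.
have yA_ge k j : s%:C ^+ k * y 0 j <= (y *m A ^+ k) 0 j.
  elim: k j => [|k IHk] j; first by rewrite mul1r mulmx1.
  rewrite mulmx_exprSr exprSr -mulrA.
  rewrite (le_trans (ler_wpM2l _ (y_sub j))) ?exprn_ge0 //.
  rewrite [leRHS]mxE mxE mulr_sumr; apply: ler_sum => l _.
  by rewrite mulrA ler_wpM2r.
have /complex_realP[c cE] := ger0_real (y_ge0 i).
have c_gt0 : 0 < c by rewrite -ltcR -cE lt_def yi_neq0 y_ge0.
have /complex_realP[d dE] : C \is Num.real.
  by rewrite ger0_real //; have := HC 0; rewrite expr0 mulr1; apply: le_trans.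
have [k] := geometric_dominates d r_gt0 r_lt c_gt0.
rewrite ltNge => /negP[]; rewrite -lecR !rmorphM !rmorphXn /= -cE -dE.
apply: le_trans (HC k); rewrite -colE [in leRHS]mxE mulrC.
rewrite (le_trans (yA_ge k i)) // real_ler_norm // ger0_real //.
by rewrite (le_trans _ (yA_ge k i)) // mulr_ge0 ?exprn_ge0.
Qed.

Lemma adjacency_ge0 (K : numDomainType) n (D : digraph n) i j :
  0 <= adjacency K D i j.
Proof. by rewrite mxE ler0n. Qed.

Lemma adjacency_gt0 (K : numDomainType) n (D : digraph n) i j :
  (0 < adjacency K D i j) = Defs.arc D i j.
Proof. by rewrite mxE ltr0n. Qed.

(* Each application of [1 + A] extends the support along all arcs leaving it. *)
Lemma irreducible_pos (K : numDomainType) n (D : digraph n) (w : 'rV[K]_n) :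
    irreducible D -> (forall i, 0 <= w 0 i) -> w != 0 ->
  exists N, forall i, 0 < (w *m (1 + adjacency K D) ^+ N) 0 i.
Proof.
move=> /forallP irrD w_ge0 /rV0Pn[i0 wi0].
set Q := 1 + _; pose z k := w *m Q ^+ k.
have zS k i : z k.+1 0 i = z k 0 i + \sum_j z k 0 j * adjacency K D j i.
  by rewrite /z mulmx_exprSr mulmxDr mulmx1 mxE [X in _ + X]mxE.
have z_ge0 k i : 0 <= z k 0 i.
  elim: k i => [|k IHk] i; first by rewrite /z mulmx1.
  by rewrite zS addr_ge0 // sumr_ge0 // => j _; rewrite mulr_ge0 ?adjacency_ge0.
have z_mono k l i : 0 < z k 0 i -> (k <= l)%N -> 0 < z l 0 i.
  move=> zk; elim: l => [|l IHl]; first by rewrite leqn0 => /eqP k0; rewrite k0 in zk.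
  rewrite leq_eqVlt => /predU1P[<-//|/IHl zl].
  by rewrite zS ltr_pwDl // sumr_ge0 // => j _; rewrite mulr_ge0 ?adjacency_ge0.
have z_path p : forall k i, path (Defs.arc D) i p -> 0 < z k 0 i ->
    exists l, 0 < z l 0 (last i p).
  elim: p => [|j p IHp] k i /=; first by exists k.
  case/andP=> ij jp zi; apply: (IHp k.+1) => //.
  rewrite zS ltr_wpDl // (bigD1 i) //= ltr_pwDl ?mulr_gt0 ?adjacency_gt0 //.
  by rewrite sumr_ge0 // => l _; rewrite mulr_ge0 ?adjacency_ge0.
have /fin_all_exists[f fP] : forall i, exists l, 0 < z l 0 i.
  move=> i; have /forallP/(_ i)/connectP[p ip ->] := irrD i0.
  by apply: (z_path _ 0) => //; rewrite /z mulmx1 lt_def wi0 w_ge0.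
by exists (\max_i f i) => i; apply: z_mono (fP i) _; apply: leq_bigmax.
Qed.

Lemma eigen_exp (K : comNzRingType) n (A : 'M[K]_n) (a : K) (y : 'rV[K]_n) N :
  y *m A = a *: y -> y *m A ^+ N = a ^+ N *: y.
Proof.
move=> yA; elim: N => [|N IHN]; first by rewrite mulmx1 scale1r.
by rewrite mulmx_exprSr IHN -scalemxAl yA scalerA -exprSr.
Qed.

(** Powers of [1 + adjacency K D] only rescale [y], so a zero entry would stay zero, against
    [irreducible_pos]. *)
Lemma irreducible_eigen_pos (K : numDomainType) n (D : digraph n) (a : K)
    (y : 'rV[K]_n) :
    irreducible D -> (forall i, 0 <= y 0 i) -> y != 0 ->
    y *m adjacency K D = a *: y ->
  forall i, 0 < y 0 i.
Proof.
move=> irrD y_ge0 y_neq0 yA i; rewrite lt_def y_ge0 andbT.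
have [N /(_ i)] := irreducible_pos irrD y_ge0 y_neq0.
rewrite (@eigen_exp _ _ _ (1 + a)) ?mulmxDr ?mulmx1 ?yA ?scalerDl ?scale1r //.
by rewrite mxE; apply: contraTneq => ->; rewrite mulr0 ltxx.
Qed.

(** * Perron-Frobenius theory for irreducible and aperiodic digraphs *)

Lemma eigen_sub (K : comNzRingType) n (A : 'M[K]_n) (a b : K) (x y : 'rV[K]_n) :
  x *m A = a *: x -> y *m A = a *: y -> (x - b *: y) *m A = a *: (x - b *: y).
Proof.
by move=> xA yA; rewrite mulmxBl -scalemxAl xA yA scalerBr !scalerA mulrC.
Qed.

(* If [y A - rho y] were nonzero, then multiplying by a power of [1 + A] would
   give [z] with [z A > rho z] entrywise, hence [z A >= (rho + d) z]. *)
Lemma subinvariant_eigen (R : realType) n (D : digraph n) (rho : R)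
    (A := adjacency R[i] D) (y : 'rV[R[i]]_n) :
    0 < rho -> irreducible D -> (forall a, eigenvalue A a -> `|a| <= rho%:C) ->
    (forall i, 0 <= y 0 i) -> y != 0 ->
    (forall j, rho%:C * y 0 j <= (y *m A) 0 j) ->
  y *m A = rho%:C *: y.
Proof.
move=> rho_gt0 irrD A_le y_ge0 y_neq0 y_sub; apply/eqP; rewrite -subr_eq0.
set w := _ - _; apply/negPn/negP => w_neq0.
have w_ge0 i : 0 <= w 0 i.
  by rewrite mxBZE subr_ge0.
have [M wM] := irreducible_pos irrD w_ge0 w_neq0.
set Q := (1 + _) ^+ M in wM; set z := y *m Q.
have QA : Q *m A = A *m Q.
  rewrite /Q -![_ *m _]/(_ * _); apply/esym/commrX.
  by apply/commrD; [apply: commr1 | ].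
have wQ : w *m Q = z *m A - rho%:C *: z.
  by rewrite /w mulmxBl -scalemxAl -!mulmxA QA.
have Q_ge0 i j : 0 <= Q i j.
  rewrite /Q; elim: M {Q wM z QA wQ} i j => [|M IHM] i j.
    by rewrite mxE; case: eqP.
  rewrite exprS mxE sumr_ge0 // => k _; rewrite mulr_ge0 // mxE addr_ge0 //.
    by rewrite mxE; case: eqP.
  exact: adjacency_ge0.
have z_ge0 i : 0 <= z 0 i.
  by rewrite mxE sumr_ge0 // => j _; rewrite mulr_ge0.
have z_neq0 : z != 0.
  apply: contraNneq w_neq0 => z0; have := wQ.
  rewrite z0 mul0mx scaler0 subr0 => wQ0.
  by apply/eqP/rowP => i; have := wM i; rewrite wQ0 mxE ltxx.
(* With [b] and [c] the entries of [z] and [w *m Q], the witness [c / (1 + b)] also covers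
   [b = 0]. *)
have /fin_all_exists2[f f_gt0 fP] : forall i, exists2 d : R, 0 < d &
    d%:C * z 0 i <= (w *m Q) 0 i.
  move=> i; have := wM i; have := z_ge0 i.
  have /complex_realP[b ->] := ger0_real (z_ge0 i).
  have /complex_realP[c ->] := gtr0_real (wM i).
  rewrite lecR ltcR => b_ge0 c_gt0; exists (c / (1 + b)).
    by rewrite divr_gt0 // ltr_pwDl.
  rewrite -rmorphM lecR /= mulrAC ler_pdivrMr ?ltr_pwDl //.
  by rewrite ler_wpM2l ?lerDr // ltW.
(* The default [1] is an arbitrary positive number: what matters is [0 < d <= f i]. *)
pose d := \big[Num.min/1]_i f i.
have d_gt0 : 0 < d by apply: lt_bigmin => //; rewrite ltr01.
have : rho + d <= rho.
  apply: (subinvariant_le rho_gt0 (@adjacency_ge0 _ _ _) A_le z_ge0 z_neq0) => j.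
  have zAE : (z *m A) 0 j = rho%:C * z 0 j + (w *m Q) 0 j.
    by rewrite wQ mxBZE [RHS]addrC subrK.
  rewrite zAE rmorphD mulrDl lerD2l (le_trans _ (fP j)) //.
  by rewrite ler_wpM2r // lecR bigmin_le.
by rewrite gerDl leNgt d_gt0.
Qed.

(** A closed walk makes [zeta] a root of unity. If [d] is its order, the values of [phi] sort the
    vertices into [d] cyclic classes, so aperiodicity forces [d = 1]. *)
Lemma aperiodic_phase (F : fieldType) n (D : digraph n) (phi : 'I_n -> F)
    (zeta : F) i0 j0 :
    irreducible D -> aperiodic D -> Defs.arc D i0 j0 ->
    (forall i, phi i != 0) ->
    (forall i j, Defs.arc D i j -> phi j = zeta * phi i) ->
  zeta = 1.
Proof.
move=> /forallP irrD [_ aperD] ij0 phi_neq0 phi_arc.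
have phi_path i p : path (Defs.arc D) i p ->
    phi (last i p) = zeta ^+ size p * phi i.
  elim: p i => [|j p IHp] i /=; first by rewrite mul1r.
  by case/andP=> /phi_arc ij /IHp ->; rewrite ij mulrA -exprSr.
have phi_reach i j : exists k, phi j = zeta ^+ k * phi i.
  have /forallP/(_ j)/connectP[p ip ->] := irrD i.
  by exists (size p); apply: phi_path.
have [k phi_i0] := phi_reach j0 i0.
have zeta_unity : zeta ^+ k.+1 = 1.
  apply: (mulIf (phi_neq0 i0)).
  by rewrite mul1r exprSr -mulrA -(phi_arc _ _ ij0).
have [d d_prim _] := prim_order_exists (ltn0Sn k) zeta_unity.
have d_gt0 := prim_order_gt0 d_prim.
have ratio_unity i : (phi i / phi i0) ^+ d = 1.
  have [l ->] := phi_reach i0 i.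
  by rewrite mulfK // exprAC (prim_expr_order d_prim) expr1n.
(* The class of [i] is the exponent of [zeta] in [phi i / phi i0]. *)
pose cl i := sval (prim_rootP d_prim (ratio_unity i)).
have clP i : phi i / phi i0 = zeta ^+ cl i.
  exact: svalP (prim_rootP d_prim (ratio_unity i)).
have cl_arc i j : Defs.arc D i j -> cl j = ordS (cl i).
  move=> /phi_arc ij; apply/val_inj => /=; apply/eqP.
  rewrite -[cl j : nat](modn_small (ltn_ord _)) -(eq_prim_root_expr d_prim).
  by rewrite -clP ij exprS -clP mulrA.
have out_arc i : exists j, Defs.arc D i j.
  have /forallP/(_ i0)/connectP[[|j p] /= ip i0E] := irrD i.
    by exists j0; rewrite -i0E.
  by exists j; case/andP: ip.
(* Following arcs forward from [i0], which has class [0], meets all classes in turn. *)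
have cl_surj c : exists i, cl i = c.
  suff cl_mod q : exists i, cl i = (q %% d)%N :> nat.
    have [i iE] := cl_mod c; exists i; apply: val_inj.
    by rewrite /= iE modn_small.
  elim: q => [|q [i iq]].
    exists i0; apply/eqP; rewrite -[cl i0 : nat](modn_small (ltn_ord _)).
    by rewrite -(eq_prim_root_expr d_prim) -clP divff ?expr0.
  have [j /cl_arc ij] := out_arc i; exists j.
  by rewrite ij /= iq -addn1 modnDml addn1.
have /aperD d_le1 : p_cyclic D d by exists cl.
have d1 : d = 1%N by apply/eqP; rewrite eqn_leq d_le1.
by have := prim_expr_order d_prim; rewrite d1 expr1.
Qed.

(** Subtract from [x] the largest multiple of [y] that leaves a nonnegative vector. The difference
    has a zero entry, so by [irreducible_eigen_pos] it cannot be a nonzero eigenvector. *)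
Lemma irreducible_eigen_unique (R : realType) n (D : digraph n) (a : R[i])
    (A := adjacency R[i] D) (x y : 'rV[R[i]]_n) :
    irreducible D -> (forall i, 0 <= x 0 i) -> x != 0 ->
    (forall i, 0 <= y 0 i) -> y != 0 ->
    x *m A = a *: x -> y *m A = a *: y ->
  exists c, x = c *: y.
Proof.
move=> irrD x_ge0 x_neq0 y_ge0 y_neq0 xA yA.
have x_gt0 := irreducible_eigen_pos irrD x_ge0 x_neq0 xA.
have y_gt0 := irreducible_eigen_pos irrD y_ge0 y_neq0 yA.
have /rV0Pn[i0 _] := x_neq0.
have ratio_real : {in predT, forall i, x 0 i / y 0 i \is Num.real}.
  by move=> i _; rewrite ger0_real // divr_ge0.
have [//|i _ i_min] := @real_arg_minP _ _ i0 predT _ _ ratio_real.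
set c := x 0 i / y 0 i in i_min; exists c.
apply/eqP; rewrite -subr_eq0; apply/negPn/negP => w_neq0.
have w_ge0 j : 0 <= (x - c *: y) 0 j.
  by rewrite mxBZE subr_ge0 -ler_pdivlMr // i_min.
have := irreducible_eigen_pos irrD w_ge0 w_neq0 (eigen_sub c xA yA) i.
by rewrite mxBZE /c divfK ?subrr ?ltxx // gt_eqF.
Qed.

(** By the triangle inequality the vector of moduli is subinvariant, hence a [rho]-eigenvector, so
    equality holds throughout. The phase of [x] then changes by the fixed factor [rho%:C / lambda]
    along arcs; aperiodicity makes this factor [1] and irreducibility makes the phase constant. *)
Lemma peripheral_eigen_norm (R : realType) n (D : digraph n) (rho : R)
    (A := adjacency R[i] D) (lambda : R[i]) (x : 'rV[R[i]]_n) :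
    0 < rho -> irreducible D -> aperiodic D ->
    (forall a, eigenvalue A a -> `|a| <= rho%:C) ->
    `|lambda| = rho%:C -> x *m A = lambda *: x -> x != 0 ->
  [/\ map_mx Num.norm x *m A = rho%:C *: map_mx Num.norm x,
      map_mx Num.norm x != 0 &
      exists2 t, t != 0 & x = t *: map_mx Num.norm x].
Proof.
move=> rho_gt0 irrD aperD A_le norm_lambda xA x_neq0; set y := map_mx _ x.
have rho_gt0C : 0 < rho%:C by rewrite ltcR.
have yE i : y 0 i = `|x 0 i| by rewrite mxE.
have y_ge0 i : 0 <= y 0 i by rewrite yE.
have y_neq0 : y != 0.
  have /rV0Pn[i xi] := x_neq0; apply/rV0Pn; exists i.
  by rewrite yE normr_eq0.
have xAE j : lambda * x 0 j = \sum_i x 0 i * A i j.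
  by have /rowP/(_ j) := xA; rewrite !mxE => <-.
have yAE j : (y *m A) 0 j = \sum_i `|x 0 i * A i j|.
  rewrite mxE; apply: eq_bigr => i _.
  by rewrite yE normrM [`|A i j|]ger0_norm ?adjacency_ge0.
have yA : y *m A = rho%:C *: y.
  apply: subinvariant_eigen => // j.
  by rewrite yAE yE -norm_lambda -normrM xAE ler_norm_sum.
have y_gt0 := irreducible_eigen_pos irrD y_ge0 y_neq0 yA.
split=> //.
have lambda_neq0 : lambda != 0 by rewrite -normr_eq0 norm_lambda gt_eqF.
have x_coef_neq0 i : x 0 i != 0 by rewrite -normr_eq0 -yE gt_eqF.
pose phi i := x 0 i / y 0 i.
have phi_arc i j : Defs.arc D i j -> phi j = rho%:C / lambda * phi i.
  (* Equality in the triangle inequality gives all terms of the sum at [j] a common phase [t]. *)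
  move=> ij; have : `|\sum_l x 0 l * A l j| = \sum_l `|x 0 l * A l j|.
    by rewrite -xAE -yAE yA normrM norm_lambda [in RHS]mxE yE.
  case/normC_sum_eq => t _ tP.
  have phi_i : phi i = t.
    have := tP i isT; rewrite normrM [`|A i j|]ger0_norm ?adjacency_ge0 //.
    have Aij : A i j != 0 by rewrite gt_eqF // adjacency_gt0.
    rewrite -yE mulrAC => /(mulIf Aij).
    by rewrite /phi => ->; rewrite mulrAC divff ?mul1r // gt_eqF.
  have := xAE j; rewrite (eq_bigr _ (fun l _ => tP l isT)) -mulr_suml -yAE yA.
  rewrite [(_ *: _ : 'M__) _ _]mxE -phi_i => xj.
  apply: (mulfI lambda_neq0); rewrite [phi j]/phi mulrA xj.
  rewrite mulrAC mulfK ?gt_eqF //.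
  by rewrite [RHS]mulrA [X in _ = X * _]mulrC divfK.
have [j0 yj0] := rV0Pn _ y_neq0.
have [i0 ij0] : exists i, Defs.arc D i j0.
  apply/existsP; apply: contraTT (y_gt0 j0) => /existsPn no_arc.
  have /eqP : (rho%:C *: y) 0 j0 = 0.
    rewrite -yA mxE big1 // => i _; have := no_arc i.
    by rewrite /= -eqn0Ngt [A _ _]mxE => /eqP->; rewrite mulr0.
  by rewrite mxE mulf_eq0 gt_eqF //= => /eqP->; rewrite ltxx.
have phi_neq0 i : phi i != 0 by rewrite mulf_neq0 // invr_neq0 // gt_eqF.
have zeta1 := aperiodic_phase irrD aperD ij0 phi_neq0 phi_arc.
exists (phi i0) => //; apply/rowP => i; rewrite [RHS]mxE.
suff /eqP<- : phi i == phi i0 by rewrite divfK ?gt_eqF.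
have phi_closed : closed (Defs.arc D) [pred j | phi j == phi i0].
  by move=> j k /phi_arc; rewrite zeta1 mul1r !inE => ->.
have /forallP/(_ i0)/forallP/(_ i) := irrD.
by move/(closed_connect phi_closed); rewrite !inE eqxx => <-.
Qed.

(** Both vectors are multiples of their vectors of moduli, which are nonnegative [rho]-eigenvectors;
    [a] and [b] may differ a priori. *)
Lemma peripheral_eigen_unique (R : realType) n (D : digraph n) (rho : R)
    (A := adjacency R[i] D) (a b : R[i]) (x y : 'rV[R[i]]_n) :
    0 < rho -> irreducible D -> aperiodic D ->
    (forall a, eigenvalue A a -> `|a| <= rho%:C) ->
    `|a| = rho%:C -> x *m A = a *: x -> x != 0 ->
    `|b| = rho%:C -> y *m A = b *: y -> y != 0 ->
  exists c, x = c *: y.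
Proof.
move=> rho_gt0 irrD aperD A_le norm_a xA x_neq0 norm_b yA y_neq0.
have [nxA nx_neq0 [s _ ->]] :=
  peripheral_eigen_norm rho_gt0 irrD aperD A_le norm_a xA x_neq0.
have [nyA ny_neq0 [t t_neq0 yE]] :=
  peripheral_eigen_norm rho_gt0 irrD aperD A_le norm_b yA y_neq0.
have norm_ge0 (z : 'rV[R[i]]_n) i : 0 <= map_mx Num.norm z 0 i by rewrite mxE.
have [c ->] :=
  irreducible_eigen_unique irrD (norm_ge0 x) nx_neq0 (norm_ge0 y) ny_neq0 nxA nyA.
by exists (s * c / t); rewrite [in RHS]yE !scalerA divfK.
Qed.

(** * Components, and eigenvectors restricted to them *)

Lemma arc_induced n (D : digraph n) (S : {set 'I_n}) i j :
  Defs.arc (induced D S) i j = Defs.arc D (enum_val i) (enum_val j).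
Proof. by rewrite /Defs.arc /= ffunE. Qed.

Lemma connect_induced n (D : digraph n) (S : {set 'I_n}) i j :
  connect (Defs.arc (induced D S)) i j ->
  connect (Defs.arc D) (enum_val i) (enum_val j).
Proof.
case/connectP=> p + ->; elim: p i => [|k p IHp] i /=; first by rewrite connect0.
rewrite -/(Defs.arc _ _ _) arc_induced => /andP[/connect1 ik /IHp].
exact: connect_trans.
Qed.

Definition strong_class n (D : digraph n) (v : 'I_n) : {set 'I_n} :=
  [set w | connect (Defs.arc D) v w && connect (Defs.arc D) w v].

(** Every vertex on a walk between two members of the class is itself a member, so the walk survives
    in the induced subdigraph. *)
Lemma irreducible_strong_class n (D : digraph n) v :
  irreducible (induced D (strong_class D v)).
Proof.
set S := strong_class D v; apply/forallP => i; apply/forallP => j.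
have /connectP[p ip jE] : connect (Defs.arc D) (enum_val i) (enum_val j).
  have := enum_valP i; have := enum_valP j; rewrite !inE.
  by case/andP=> vj _ /andP[_ iv]; apply: connect_trans vj.
elim: p i ip jE => [|b p IHp] i /=; first by move=> _ /enum_val_inj ->.
case/andP=> ib bp jE.
have bS : b \in S.
  have := enum_valP i; have := enum_valP j; rewrite !inE.
  case/andP=> _ jv /andP[vi _].
  rewrite (connect_trans vi (connect1 ib)) (connect_trans _ jv) //.
  by apply/connectP; exists p.
have bE := enum_rankK_in bS bS; set k := enum_rank_in bS b in bE.
apply: connect_trans (IHp k _ _); rewrite ?bE //.
by apply: connect1; rewrite arc_induced bE.
Qed.

Lemma strong_class_component n (D : digraph n) v :
  strong_class D v \in components D.
Proof.
rewrite inE; apply/maxsetP; split=> [|S irrS vS].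
  exact: irreducible_strong_class.
apply/eqP; rewrite eqEsubset vS andbT; apply/subsetP => w wS.
have {}vS : v \in S by rewrite (subsetP vS) // inE connect0.
have S_conn a b : a \in S -> b \in S -> connect (Defs.arc D) a b.
  move=> aS bS; rewrite -(enum_rankK_in aS aS) -(enum_rankK_in bS bS).
  by apply: connect_induced; have /forallP/(_ _)/forallP := irrS; apply.
by rewrite inE !S_conn.
Qed.

Lemma adjacency_induced (K : pzSemiRingType) n (D : digraph n) (S : {set 'I_n}) i j :
  adjacency K (induced D S) i j = adjacency K D (enum_val i) (enum_val j).
Proof. by rewrite !mxE ffunE. Qed.

(** The moduli of an eigenvector of the subdigraph, extended by zero, satisfy [|a| y <= y A], so
    [subinvariant_le] applies. *)
Lemma induced_eigenvalue_le (R : realType) n (D : digraph n) (S : {set 'I_n})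
    (rho : R) :
    0 < rho ->
    (forall a, eigenvalue (adjacency R[i] D) a -> `|a| <= rho%:C) ->
  forall a, eigenvalue (adjacency R[i] (induced D S)) a -> `|a| <= rho%:C.
Proof.
move=> rho_gt0 A_le a /eigenvalueP[x xA x_neq0].
have /complex_realP[s sE] := normr_real a; rewrite sE lecR.
(* The sum has one term for [j] in [S] and none otherwise: this is extension by zero. *)
pose y := \row_j \sum_(i < #|S| | enum_val i == j) `|x 0 i|.
have yS k : y 0 (enum_val k) = `|x 0 k|.
  rewrite mxE (bigD1 k) //= big1 ?addr0 // => i /andP[/eqP/enum_val_inj->].
  by rewrite eqxx.
have y_ge0 j : 0 <= y 0 j by rewrite mxE sumr_ge0.
have yA j : (y *m adjacency R[i] D) 0 j =
    \sum_i `|x 0 i| * adjacency R[i] D (enum_val i) j.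
  rewrite mxE (bigID (mem S)) /= addrC big1 ?add0r => [|l lS].
    by rewrite big_enum_val; apply: eq_bigr => i _; rewrite yS.
  rewrite [y _ _]mxE big1 ?mul0r // => i /eqP il.
  by rewrite -il enum_valP in lS.
apply: (subinvariant_le rho_gt0 _ A_le y_ge0) => [i j||j].
- exact: adjacency_ge0.
- have /rV0Pn[i xi] := x_neq0; apply/rV0Pn; exists (enum_val i).
  by rewrite yS normr_eq0.
rewrite yA; have [jS|jS] := boolP (j \in S); last first.
  rewrite [y _ _]mxE big1 ?mulr0 => [|i /eqP ij].
    by rewrite sumr_ge0 // => i _; rewrite mulr_ge0 ?adjacency_ge0.
  by rewrite -ij enum_valP in jS.
rewrite -(enum_rankK_in jS jS); set k := enum_rank_in jS j.
rewrite yS -sE -normrM.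
have -> : a * x 0 k = (a *: x) 0 k by rewrite [RHS]mxE.
rewrite -xA mxE (le_trans (ler_norm_sum _ _ _)) //; apply: ler_sum => i _.
by rewrite normrM adjacency_induced [`|adjacency _ _ _ _|]ger0_norm ?adjacency_ge0.
Qed.

(* The class [S] is one that no other class meeting the support of [x]
   reaches, so that [x A] depends on [S] only through [x] restricted to [S]. *)
Lemma eigen_source_class (K : numDomainType) n (D : digraph n) (a : K)
    (x : 'rV[K]_n) :
    x *m adjacency K D = a *: x -> x != 0 ->
  exists S, [/\ S \in components D, colsub (@enum_val _ (mem S)) x != 0 &
    colsub enum_val x *m adjacency K (induced D S) =
      a *: colsub enum_val x].
Proof.
move=> xA /rV0Pn[v0 xv0].
pose preds v := [set w | connect (Defs.arc D) w v].
(* [v] has the fewest ancestors among the vertices of the support, so any support vertex reaching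
   [v] has the same ancestors and is reached from [v]. *)
case: (@arg_minnP _ v0 (fun v => x 0 v != 0) (fun v => #|preds v|) xv0) => v xv v_min.
have v_source w : x 0 w != 0 -> connect (Defs.arc D) w v ->
    connect (Defs.arc D) v w.
  move=> xw wv; have wv_sub : preds w \subset preds v.
    by apply/subsetP => u; rewrite !inE => /connect_trans; apply.
  have /setP/(_ v) : preds w = preds v.
    by apply/eqP; rewrite eqEcard wv_sub v_min.
  by rewrite !inE connect0.
set S := strong_class D v; exists S.
have vS : v \in S by rewrite inE connect0.
split; first exact: strong_class_component.
  apply/rV0Pn; exists (enum_rank_in vS v).
  by rewrite mxE enum_rankK_in.
apply/rowP => k; have /rowP/(_ (enum_val k)) := xA.
rewrite [LHS]mxE (bigID (mem S)) /= addrC big1 => [|l lS].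
  rewrite add0r big_enum_val => xk; rewrite [RHS]mxE mxE.
  rewrite mxE in xk; rewrite mxE -xk; apply: eq_bigr => i _.
  by rewrite adjacency_induced [colsub _ _ _ _]mxE.
have [->|xl] := eqVneq (x 0 l) 0; first by rewrite mul0r.
have [lk|/negPf lk] := boolP (Defs.arc D l (enum_val k)); last first.
  move/negbT: lk; rewrite /= -eqn0Ngt mxE => /eqP->; exact: mulr0.
have := enum_valP k; rewrite inE => /andP[_ kv].
have lv := connect_trans (connect1 lk) kv.
by case/negP: lS; rewrite inE v_source.
Qed.

(** * Deflation, uniqueness of the dominant eigenvector, and the asymptotics *)

Lemma deflated_eigen (F : fieldType) n (A : 'M[F]_n) (a b : F) (vL x : 'rV[F]_n)
    (vR : 'cV[F]_n) :
    A *m vR = a *: vR -> vL *m vR = 1%:M ->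
    x *m (A - a *: (vR *m vL)) = b *: x -> b != 0 ->
  x *m vR = 0 /\ x *m A = b *: x.
Proof.
move=> AvR vLR xB b_neq0.
have xvR : x *m vR = 0.
  apply: (scalerI b_neq0); rewrite scaler0 scalemxAl -xB -mulmxA mulmxBl AvR.
  by rewrite -scalemxAl -mulmxA vLR mulmx1 subrr mulmx0.
split=> //; move: xB.
by rewrite mulmxBr -scalemxAr mulmxA xvR mul0mx scaler0 subr0.
Qed.

(** The rank-one correction vanishes at each step because [vL A^k w = a^k vL w = 0]. *)
Lemma deflated_exp (K : comNzRingType) n (A : 'M[K]_n) (a : K) (vL : 'rV[K]_n)
    (vR w : 'cV[K]_n) k :
    vL *m A = a *: vL -> vL *m w = 0 ->
  (A - a *: (vR *m vL)) ^+ k *m w = A ^+ k *m w.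
Proof.
move=> vLA vLw; elim: k => [|k IHk] //.
rewrite !exprS -![_ * _ ^+ k]/(_ *m _ ^+ k) -!mulmxA IHk mulmxBl -scalemxAl.
rewrite -mulmxA [vL *m _]mulmxA (eigen_exp _ vLA) -scalemxAl vLw.
by rewrite scaler0 mulmx0 scaler0 subr0.
Qed.

(** Any eigenvector of modulus [rho] restricts to a nonzero eigenvector on a source class of its
    support, which must be [D1]. Uniqueness on [D1] therefore carries over to the whole digraph. *)
Lemma dominant_eigen_unique (R : realType) (m : nat) (D : digraph m) (rho : R)
    (D1 : {set 'I_m}) (A := adjacency R[i] D) (x y : 'rV[R[i]]_m) (a : R[i]) :
    0 < rho -> (forall a, eigenvalue A a -> `|a| <= rho%:C) ->
    D1 \in components D -> aperiodic (induced D D1) ->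
    (forall S, S \in components D -> S != D1 ->
      ~ is_spectral_radius (adjacency R[i] (induced D S)) rho) ->
    `|a| = rho%:C -> x *m A = a *: x ->
    y *m A = rho%:C *: y -> y != 0 ->
  exists c, x = c *: y.
Proof.
move=> rho_gt0 A_le D1_comp aperD1 other_rho norm_a xA yA y_neq0.
pose restr (z : 'rV[R[i]]_m) := colsub (@enum_val _ (mem D1)) z.
have restr_eigen (b : R[i]) z : `|b| = rho%:C -> z *m A = b *: z -> z != 0 ->
    restr z != 0 /\ restr z *m adjacency R[i] (induced D D1) = b *: restr z.
  move=> norm_b zA z_neq0.
  have [S [S_comp zS_neq0 zSA]] := eigen_source_class zA z_neq0.
  suff /eqP SD1 : S == D1 by rewrite SD1 in zS_neq0 zSA.
  apply: contraT => /(other_rho _ S_comp)[]; split.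
    by exists b => //; apply/eigenvalueP; exists (colsub enum_val z).
  exact: induced_eigenvalue_le.
have irrD1 : irreducible (induced D D1).
  by move: D1_comp; rewrite inE => /maxsetP[].
have norm_rho : `|rho%:C| = rho%:C :> R[i] by rewrite ger0_norm // lecR ltW.
have [->|x_neq0] := eqVneq x 0; first by exists 0; rewrite scale0r.
have [rx_neq0 rxA] := restr_eigen _ _ norm_a xA x_neq0.
have [ry_neq0 ryA] := restr_eigen _ _ norm_rho yA y_neq0.
have D1_le := induced_eigenvalue_le (S := D1) rho_gt0 A_le.
have [c xy] := peripheral_eigen_unique rho_gt0 irrD1 aperD1 D1_le
  norm_a rxA rx_neq0 norm_rho ryA ry_neq0.
have a_rho : a = rho%:C.
  have /eqP : a *: restr x = rho%:C *: restr x.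
    by rewrite -rxA xy -scalemxAl ryA !scalerA mulrC.
  by rewrite -subr_eq0 -scalerBl scaler_eq0 (negPf rx_neq0) orbF subr_eq0 => /eqP.
(* [x - c *: y] is a [rho]-eigenvector that vanishes on [D1], so it is zero. *)
rewrite a_rho in xA; exists c; apply/eqP; rewrite -subr_eq0.
apply: contraT => /(restr_eigen _ _ norm_rho (eigen_sub c xA yA))[/eqP[]].
apply/rowP => k; have /rowP/(_ k) := xy; rewrite !mxE => ->.
exact: subrr.
Qed.

Theorem mainTheorem12 (R : realType) (m : nat) (D : digraph m) (rho : R)
    (D1 : {set 'I_m}) (vL : 'rV[R[i]]_m) (vR : 'cV[R[i]]_m)
    (A := adjacency R[i] D)
    (rho_gt0 : 0 < rho)
    (rhoA : is_spectral_radius A rho)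
    (D1_comp : D1 \in components D)
    (D1_rho : is_spectral_radius (adjacency R[i] (induced D D1)) rho)
    (Di_rho : forall Di : {set 'I_m}, Di \in components D -> Di != D1 ->
       forall r : R, is_spectral_radius (adjacency R[i] (induced D Di)) r ->
         r != rho)
    (D1_aper : aperiodic (induced D D1))
    (vL_eigen : vL *m A = rho%:C *: vL)
    (vR_eigen : A *m vR = rho%:C *: vR)
    (vLR : vL *m vR = 1%:M) :
  forall (wL : 'rV[R[i]]_m) (wR : 'cV[R[i]]_m),
  exists (C eps : R) (p : nat -> R[i]),
    [/\ 0 < C, 0 < eps &
      forall n : nat,
        (wL *m A ^+ n *m wR) 0 0 =
          ((wL *m vR) 0 0 * (vL *m wR) 0 0 + p n) * rho%:C ^+ n
        /\ `|p n| < (C * (1 - eps) ^+ n)%:C].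

Proof.
move=> wL wR; have [_ A_le] := rhoA.
have rho_gt0C : 0 < rho%:C by rewrite ltcR.
have rho_neq0 : rho%:C != 0 :> R[i] by rewrite gt_eqF.
have vL_neq0 : vL != 0.
  apply: contra_eqN vLR => /eqP->; rewrite mul0mx eq_sym.
  by apply/eqP => /matrixP/(_ 0 0)/eqP; rewrite !mxE oner_eq0.
have other_rho S : S \in components D -> S != D1 ->
    ~ is_spectral_radius (adjacency R[i] (induced D S)) rho.
  by move=> S_comp SD1 /(Di_rho _ S_comp SD1); rewrite eqxx.
pose B := A - rho%:C *: (vR *m vL).
have B_lt b : eigenvalue B b -> `|b| < rho%:C.
  case/eigenvalueP=> x xB x_neq0.
  have [->|b_neq0] := eqVneq b 0; first by rewrite normr0.
  have [xvR xA] := deflated_eigen vR_eigen vLR xB b_neq0.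
  rewrite lt_def A_le ?andbT; last by apply/eigenvalueP; exists x.
  apply: contraNneq x_neq0 => /esym norm_b.
  have [c xE] := dominant_eigen_unique rho_gt0 A_le D1_comp D1_aper other_rho
    norm_b xA vL_eigen vL_neq0.
  move: xvR; rewrite xE -scalemxAl vLR => /matrixP/(_ 0 0).
  by rewrite !mxE mulr1 => ->; rewrite scale0r.
have [r [r_gt0 r_lt r_gap]] := spectral_gap rho_gt0 B_lt.
have r_gt0C : 0 < r%:C by rewrite ltcR.
(* [w] is the projection of [wR] to the kernel of [vL] along [vR]; the part removed yields the main
   term. *)
pose w := wR - vR *m (vL *m wR).
have vLw : vL *m w = 0 by rewrite mulmxBr [vL *m (vR *m _)]mulmxA vLR mul1mx subrr.
have [C HC] := exp_bound r_gt0C r_gap wL w.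
have C_ge0 : 0 <= C by have := HC 0; rewrite expr0 mulr1; apply: le_trans.
have /complex_realP[c cE] := ger0_real C_ge0.
have c_ge0 : 0 <= c by rewrite -lecR -cE.
have AvR k : A ^+ k *m vR = rho%:C ^+ k *: vR.
  elim: k => [|k IHk]; first by rewrite mul1mx scale1r.
  by rewrite exprS -[A * _]/(A *m _) -mulmxA IHk -scalemxAr vR_eigen scalerA -exprSr.
(* Here [1 - eps = r / rho], and [c + 1] instead of [c] makes the bound strict. *)
exists (c + 1), (1 - r / rho), (fun k => (wL *m B ^+ k *m w) 0 0 / rho%:C ^+ k).
split=> [||k].
- by rewrite ltr_wpDl.
- by rewrite subr_gt0 ltr_pdivrMr ?mul1r.
have wBw : (wL *m B ^+ k *m w) 0 0 = (wL *m A ^+ k *m wR) 0 0 -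
    rho%:C ^+ k * ((wL *m vR) 0 0 * (vL *m wR) 0 0).
  have -> : (wL *m vR) 0 0 * (vL *m wR) 0 0 = (wL *m vR *m (vL *m wR)) 0 0.
    by rewrite [RHS]mxE big_ord1.
  rewrite -mxBZE -mulmxA deflated_exp // mulmxBr mulmxBr.
  by rewrite [A ^+ k *m (vR *m _)]mulmxA AvR -scalemxAl -scalemxAr !mulmxA.
rewrite subKr; split.
  by rewrite mulrDl divfK ?expf_neq0 // wBw mulrC addrC subrK.
rewrite normrM normfV normrX (ger0_norm (ltW rho_gt0C)).
rewrite ltr_pdivrMr ?exprn_gt0 // (le_lt_trans (HC k)) //.
rewrite cE -!rmorphXn -!rmorphM ltcR /= -mulrA -exprMn divfK ?gt_eqF //.
by rewrite ltr_pM2r ?exprn_gt0 // ltrDl.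
Qed.
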